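(* Let the collision term be $\mathcal C(f)=-\phi_0f+\phi_0\frac12\int_{-1}^1f\,d\mu+3\mu\phi_1\frac12\int_{-1}^1f\mu\,d\mu$, with $\tilde\chi\ne0$, $\tilde\chi+\phi_0\ne0$ and $\tilde\chi+\phi_0-\phi_1\neq0$. Let $f=\sum_{i\ge0}\varepsilon^if_i$ be the Hilbert expansion for the time- and reaction-scaled Boltzmann equation $$\mathcal D_\varepsilon(f)=\varepsilon^{-1}\big(\bar j+\bar{\mathcal J}(f)\big).$$ Consider the decomposition $f=f^t+f^s$, inducing $\beta=\beta^t+\beta^s$ with $\beta^t=\frac12\int_{-1}^1f^t\,d\mu$ and $\beta^s=\frac12\int_{-1}^1f^s\,d\mu$, where one sets $\beta^t=\beta_0:=\frac12\int_{-1}^1f_0\,d\mu$. Then the diffusion-reaction-type equation $$\frac{d\beta^t}{c\,dt}+\frac13\frac{d\ln\rho}{c\,dt}\,\omega\frac{\partial\beta^t}{\partial\omega}-\frac1{r^2}\frac{\partial}{\partial r}\Big(r^2\frac\lambda3\frac{\partial\beta^t}{\partial r}\Big)=j-\tilde\chi(\beta^t+\beta^s)$$ is an approximation of the angular mean of this scaled Boltzmann equation of order $\mathcal O(\varepsilon^2)$. Furthermore, $$\Sigma_{\rm diff}:=-\frac1{r^2}\frac{\partial}{\partial r}\Big(r^2\frac\lambda3\frac{\partial\beta^t}{\partial r}\Big)+\tilde\chi\beta^s$$ is an approximation of order $\mathcal O(\varepsilon^2)$ of the (angular mean of the) diffusion source $\Sigma$ in the trapped particle equation $$\frac{d\beta^t}{c\,dt}+\frac13\frac{d\ln\rho}{c\,dt}\,\omega\frac{\partial\beta^t}{\partial\omega}=j-\tilde\chi\beta^t-\Sigma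 .$$
   Context: Variables: time $t$, radius $r>0$, cosine of the propagation angle $\mu\in[-1,1]$, energy $\omega>0$; $f=f(t,r,\mu,\omega)$. The constant $c>0$ is the speed of light; $\rho>0$ and $v$ are given functions of time and $r$ (density and radial velocity of the background matter), and $\frac{d}{dt}:=\frac{\partial}{\partial t}+v\frac{\partial}{\partial r}$. The linear operator $\mathcal D=\mathcal D^++\mathcal D^-$ is given by $$\mathcal D^+(f)=\frac{df}{c\,dt}+\mu\Big(\frac{d\ln\rho}{c\,dt}+\frac{3v}{cr}\Big)(1-\mu^2)\frac{\partial f}{\partial\mu}+\Big[\mu^2\Big(\frac{d\ln\rho}{c\,dt}+\frac{3v}{cr}\Big)-\frac v{cr}\Big]\omega\frac{\partial f}{\partial\omega},$$ $$\mathcal D^-(f)=\mu\frac{\partial f}{\partial r}+\frac1r(1-\mu^2)\frac{\partial f}{\partial\mu}.$$ The functions $j\ge0$ (emissivity), $\chi\geq 0$ (absorptivity), $\tilde\chi=j+\chi$, $\phi_0,\phi_1$ do not depend on $\mu$. Put $\mathcal J(f)=-\tilde\chi f+\mathcal C(f)$ and $\lambda=\frac1{\tilde\chi+\phi_0-\phi_1}$. Scaling: $\varepsilon>0$ is a small parameter; $j=\bar j/\varepsilon$, $\tilde\chi=\bar{\tilde\chi}/\varepsilon$, $\phi_0=\bar\phi_0/\varepsilon$, $\phi_1=\bar\phi_1/\varepsilon$, $\mathcal J=\bar{\mathcal J}/\varepsilon$ (hence $\lambda$ is of order $\varepsilon$), and $t=\bar t/\varepsilon$, $v=\varepsilon\bar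 v$ (hence $\frac{d}{dt}=\varepsilon\frac{d}{d\bar t}$ with $\frac{d}{d\bar t}=\frac{\partial}{\partial\bar t}+\bar v\frac{\partial}{\partial r}$); the barred quantities are independent of $\varepsilon$. Let $\mathcal D_\varepsilon$ be $\mathcal D$ with time scaled in this way: $\mathcal D_\varepsilon=\varepsilon\mathcal D^++\mathcal D^-$, where here (and in the hierarchy below) $\mathcal D^+$ is written with $\bar t,\bar v$ in place of $t,v$. In the two displayed approximating equations of the claim $t$ and $v$ are the unscaled quantities, i.e. $\frac{d\beta^t}{c\,dt}+\frac13\frac{d\ln\rho}{c\,dt}\omega\frac{\partial\beta^t}{\partial\omega}=\varepsilon\big(\frac{d\beta^t}{c\,d\bar t}+\frac13\frac{d\ln\rho}{c\,d\bar t}\omega\frac{\partial\beta^t}{\partial\omega}\big)$. Hilbert expansion: $f=\sum_{i\ge0}\varepsilon^if_i$, $\beta=\frac12\int_{-1}^1f\,d\mu=\sum_{i\ge0}\varepsilon^i\beta_i$, $\beta_i=\frac12\int_{-1}^1f_i\,d\mu$, $\mathcal D_\varepsilon(f)=\mathcal D^-(f_0)+\varepsilon(\mathcal D^+(f_0)+\mathcal D^-(f_1))+\varepsilon^2(\mathcal D^+(f_1)+\mathcal D^-(f_2))+\dots$, and the $f_i$ solve the hierarchy $$0=j+\mathcal J(f_0),\qquad\mathcal D^-(f_0)=\bar{\mathcal J}(f_1),\qquad\mathcal D^+(f_{i-2})+\mathcal D^-(f_{i-1})=\bar{\mathcal J}(f_i),\quad i=2,3,\dots.$$ Meaning of the conclusion: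 the angular mean of the scaled Boltzmann equation is $\frac12\int_{-1}^1\mathcal D_\varepsilon(f)\,d\mu=j-\tilde\chi\beta$. The conclusion states that its left-hand side equals the left-hand side of the displayed diffusion-reaction-type equation plus $\mathcal O(\varepsilon^2)$, and that the $\Sigma$ determined by the trapped particle equation equals $\Sigma_{\rm diff}+\mathcal O(\varepsilon^2)$. The component $f^t$ is not assumed to be isotropic, so the trapped particle equation is written for its angular mean $\beta^t$. All series are formal; series, integrals and partial derivatives are assumed to be interchangeable; $\mathcal O(\varepsilon^k)$ denotes, in the formal sense, the neglected part starting with order $\varepsilon^k$ of a formal series in $\varepsilon$. *)

(* Defs.v *)
(* Everything is over Stdlib's R, with Coquelicot's total Derive and RInt. *)
From Stdlib Require Import Reals ZArith Lra Lia.
From Coquelicot Require Import Coquelicot.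
Open Scope R_scope.

(* Radiation fields are functions of (t, r, mu, w), with mu the cosine of the
   propagation angle and w the energy; fields without angular dependence are
   functions of (t, r, w).  Only the values with 0 < r, -1 <= mu <= 1 and 0 < w
   are meaningful.  Time is the scaled time throughout. *)
Definition field := R -> R -> R -> R -> R.
Definition iso_field := R -> R -> R -> R.

Record background := Background {
  light : R;                (* speed of light c *)
  rho : R -> R -> R;        (* density, as a function of (t, r) *)
  vel : R -> R -> R         (* scaled radial velocity, as a function of (t, r) *)
}.

(* Scaled (barred, hence independent of epsilon) interaction rates; their types
   express that they do not depend on mu. *)
Record rates := Rates {
  emis : iso_field;         (* j *)
  absorp : iso_field;       (* chi *)
  phi0 : iso_field;
  phi1 : iso_field
}.

Definition chit (K : rates) : iso_field :=
  fun t r w => emis K t r w + absorp K t r w.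

Definition lambda (K : rates) : iso_field :=
  fun t r w => / (chit K t r w + phi0 K t r w - phi1 K t r w).

(* The rates before scaling, at a given value of epsilon. *)
Definition unscale (eps : R) (K : rates) : rates :=
  Rates (fun t r w => emis K t r w / eps) (fun t r w => absorp K t r w / eps)
        (fun t r w => phi0 K t r w / eps) (fun t r w => phi1 K t r w / eps).

Definition background_ok (M : background) : Prop :=
  0 < light M /\ forall t r, 0 < r -> 0 < rho M t r.

Definition rates_ok (K : rates) : Prop :=
  forall t r w, 0 < r -> 0 < w ->
    0 <= emis K t r w /\ 0 <= absorp K t r w /\
    chit K t r w <> 0 /\
    chit K t r w + phi0 K t r w <> 0 /\
    chit K t r w + phi0 K t r w - phi1 K t r w <> 0.

Definition mean (f : field) : iso_field :=
  fun t r w => / 2 * RInt (fun mu => f t r mu w) (-1) 1.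

Definition flux (f : field) : iso_field :=
  fun t r w => / 2 * RInt (fun mu => f t r mu w * mu) (-1) 1.

Definition coll (K : rates) (f : field) : field := fun t r mu w =>
  - phi0 K t r w * f t r mu w + phi0 K t r w * mean f t r w
  + 3 * mu * phi1 K t r w * flux f t r w.

Definition Jop (K : rates) (f : field) : field := fun t r mu w =>
  - chit K t r w * f t r mu w + coll K f t r mu w.

Definition dlnrho (M : background) (t r : R) : R :=
  Derive (fun s => ln (rho M s r)) t + vel M t r * Derive (fun s => ln (rho M t s)) r.

Definition Dplus (M : background) (f : field) : field := fun t r mu w =>
  let c := light M in
  let v := vel M t r in
  (Derive (fun s => f s r mu w) t + v * Derive (fun s => f t s mu w) r) / c
  + mu * (dlnrho M t r / c + 3 * v / (c * r)) * (1 - mu ^ 2)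
    * Derive (fun m => f t r m w) mu
  + (mu ^ 2 * (dlnrho M t r / c + 3 * v / (c * r)) - v / (c * r))
    * w * Derive (fun x => f t r mu x) w.

(* At mu = -1 and mu = 1 the factor 1 - mu ^ 2 vanishes, so the value of Derive
   there, which would depend on f outside [-1, 1], does not matter; the same
   holds for Dplus. *)
Definition Dminus (f : field) : field := fun t r mu w =>
  mu * Derive (fun s => f t s mu w) r
  + / r * (1 - mu ^ 2) * Derive (fun m => f t r m w) mu.

Definition trapped_transport (M : background) (b : iso_field) : iso_field :=
  fun t r w =>
  (Derive (fun s => b s r w) t + vel M t r * Derive (fun s => b t s w) r) / light M
  + 1 / 3 * (dlnrho M t r / light M) * w * Derive (fun x => b t r x) w.

Definition diffusion (l b : iso_field) : iso_field := fun t r w =>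
  - (/ r ^ 2 * Derive (fun s => s ^ 2 * (l t s w / 3) * Derive (fun y => b t y w) s) r).

(* Formal Laurent series in epsilon: A n is the coefficient of epsilon ^ n.
    Operators act coefficientwise. *)

Definition series (X : Type) := Z -> X.

Definition eps_pow {X : Type} (k : Z) (A : series X) : series X :=
  fun n => A (n - k)%Z.

Definition smap {X Y : Type} (F : X -> Y) (A : series X) : series Y :=
  fun n => F (A n).

Definition of_coefs (f : nat -> field) : series field := fun n =>
  if (n <? 0)%Z then fun _ _ _ _ => 0 else f (Z.to_nat n).

Definition const4 (a : field) : series field := fun n =>
  if (n =? 0)%Z then a else fun _ _ _ _ => 0.

Definition const3 (a : iso_field) : series iso_field := fun n =>
  if (n =? 0)%Z then a else fun _ _ _ => 0.

Definition add4 (A B : series field) : series field :=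
  fun n t r mu w => A n t r mu w + B n t r mu w.

Definition add3 (A B : series iso_field) : series iso_field :=
  fun n t r w => A n t r w + B n t r w.

Definition sub3 (A B : series iso_field) : series iso_field :=
  fun n t r w => A n t r w - B n t r w.

Definition scal3 (a : iso_field) (A : series iso_field) : series iso_field :=
  fun n t r w => a t r w * A n t r w.

Definition eq4 (A B : series field) : Prop :=
  forall n t r mu w, 0 < r -> -1 <= mu <= 1 -> 0 < w -> A n t r mu w = B n t r mu w.

Definition eq3 (A B : series iso_field) : Prop :=
  forall n t r w, 0 < r -> 0 < w -> A n t r w = B n t r w.

(* A = B + O(epsilon ^ k) *)
Definition eq3_upto (k : Z) (A B : series iso_field) : Prop :=
  forall n t r w, (n < k)%Z -> 0 < r -> 0 < w -> A n t r w = B n t r w.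

Definition Deps (M : background) (F : series field) : series field :=
  add4 (eps_pow 1 (smap (Dplus M) F)) (smap Dminus F).

Definition hilbert_hierarchy (M : background) (K : rates) (f : nat -> field) : Prop :=
  forall t r mu w, 0 < r -> -1 <= mu <= 1 -> 0 < w ->
    0 = emis K t r w + Jop K (f 0%nat) t r mu w /\
    Dminus (f 0%nat) t r mu w = Jop K (f 1%nat) t r mu w /\
    forall i, (2 <= i)%nat ->
      Dplus M (f (i - 2)%nat) t r mu w + Dminus (f (i - 1)%nat) t r mu w
      = Jop K (f i) t r mu w.

Definition scaled_boltzmann (M : background) (K : rates) (F : series field) : Prop :=
  eq4 (Deps M F)
      (eps_pow (-1) (add4 (const4 (fun t r _ w => emis K t r w)) (smap (Jop K) F))).

Definition regular (f : nat -> field) : Prop :=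
  forall i t r mu w, 0 < r -> -1 <= mu <= 1 -> 0 < w ->
    ex_derive (fun s => f i s r mu w) t /\
    ex_derive (fun s => f i t s mu w) r /\
    (-1 < mu < 1 -> ex_derive (fun m => f i t r m w) mu) /\
    ex_derive (fun x => f i t r mu x) w /\
    ex_RInt (fun m => f i t r m w) (-1) 1.

Definition angle_integrable (f : nat -> field) : Prop :=
  forall i t r w, 0 < r -> 0 < w -> ex_RInt (fun m => f i t r m w) (-1) 1.

Definition beta (f : nat -> field) : series iso_field := smap mean (of_coefs f).

(* j - chit * B for the unscaled rates j and chit, which are the scaled ones
   divided by epsilon. *)
Definition reaction (K : rates) (B : series iso_field) : series iso_field :=
  eps_pow (-1) (sub3 (const3 (emis K)) (scal3 (chit K) B)).

(* The transport terms with respect to the unscaled t and v: d/dt = epsilon d/dtbar. *)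
Definition trapped_lhs (M : background) (bt : series iso_field) : series iso_field :=
  eps_pow 1 (smap (trapped_transport M) bt).

(* The diffusion term for the unscaled lambda, which is epsilon times the scaled
   one, see lambda_unscale. *)
Definition diffusion_term (K : rates) (bt : series iso_field) : series iso_field :=
  eps_pow 1 (smap (diffusion (lambda K)) bt).

Definition diffusion_lhs (M : background) (K : rates) (bt : series iso_field) :=
  add3 (trapped_lhs M bt) (diffusion_term K bt).

Definition Sigma_diff (K : rates) (bt bs : series iso_field) : series iso_field :=
  add3 (diffusion_term K bt) (eps_pow (-1) (scal3 (chit K) bs)).

Definition trapped_equation (M : background) (K : rates)
    (bt Sigma : series iso_field) : Prop :=
  eq3 (trapped_lhs M bt) (sub3 (reaction K bt) Sigma).

Lemma lambda_unscale (K : rates) (eps t r w : R) :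
  0 < eps -> chit K t r w + phi0 K t r w - phi1 K t r w <> 0 ->
  lambda (unscale eps K) t r w = eps * lambda K t r w.
Proof.
unfold lambda, chit, unscale; simpl; intros He Hn; field; split; lra.
Qed.

Lemma Jop_unscale (K : rates) (eps : R) (f : field) (t r mu w : R) :
  0 < eps -> Jop (unscale eps K) f t r mu w = Jop K f t r mu w / eps.
Proof.
unfold Jop, coll, chit, unscale; simpl; intros He; field; lra.
Qed.

Lemma mean_zero t r w : mean (fun _ _ _ _ => 0) t r w = 0.
Proof. unfold mean; rewrite RInt_const; unfold scal; simpl; unfold mult; simpl; ring. Qed.

Lemma Dplus_zero M t r mu w : Dplus M (fun _ _ _ _ => 0) t r mu w = 0.
Proof. unfold Dplus; rewrite !Derive_const; unfold Rdiv; ring. Qed.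

Lemma Dminus_zero t r mu w : Dminus (fun _ _ _ _ => 0) t r mu w = 0.
Proof. unfold Dminus; rewrite !Derive_const; ring. Qed.

Lemma Jop_zero K t r mu w : Jop K (fun _ _ _ _ => 0) t r mu w = 0.
Proof.
unfold Jop, coll, flux; rewrite mean_zero.
rewrite (RInt_ext _ (fun _ => 0)) by (intros; simpl; apply Rmult_0_l).
rewrite RInt_const; unfold scal; simpl; unfold mult; simpl; ring.
Qed.

Lemma of_coefs_nat f (i : nat) : of_coefs f (Z.of_nat i) = f i.
Proof.
unfold of_coefs; destruct (Z.ltb_spec (Z.of_nat i) 0); [lia|].
now rewrite Nat2Z.id.
Qed.

Lemma of_coefs_neg f n : (n < 0)%Z -> of_coefs f n = fun _ _ _ _ => 0.
Proof. unfold of_coefs; destruct (Z.ltb_spec n 0); [reflexivity|lia]. Qed.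

Lemma const4_neq a n : n <> 0%Z -> const4 a n = fun _ _ _ _ => 0.
Proof. unfold const4; destruct (Z.eqb_spec n 0); [lia|reflexivity]. Qed.

Lemma hilbert_hierarchyP (M : background) (K : rates) (f : nat -> field) :
  hilbert_hierarchy M K f <-> scaled_boltzmann M K (of_coefs f).
Proof.
unfold scaled_boltzmann, eq4, Deps, add4, eps_pow, smap; split; intros H.
- intros n t r mu w Hr Hm Hw.
  destruct (H t r mu w Hr Hm Hw) as [H0 [H1 H2]].
  replace (n - -1)%Z with (n + 1)%Z by lia.
  destruct (Z_lt_le_dec n (-1)) as [Hn|Hn].
    rewrite !of_coefs_neg, const4_neq by lia.
    rewrite Dplus_zero, Dminus_zero, Jop_zero; ring.
  destruct (Z.eq_dec n (-1)) as [->|Hn1].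
    rewrite (of_coefs_neg f (-1 - 1)), (of_coefs_neg f (-1)) by lia.
    change (-1 + 1)%Z with (Z.of_nat 0); rewrite of_coefs_nat.
    rewrite Dplus_zero, Dminus_zero; unfold const4; simpl; lra.
  destruct (Z.eq_dec n 0) as [->|Hn2].
    rewrite (of_coefs_neg f (0 - 1)), const4_neq by lia.
    change (0 + 1)%Z with (Z.of_nat 1); change 0%Z with (Z.of_nat 0).
    rewrite !of_coefs_nat, Dplus_zero, H1; ring.
  rewrite const4_neq by lia.
  destruct (Z_of_nat_complete (n + 1) ltac:(lia)) as [i Hi].
  specialize (H2 i ltac:(lia)).
  replace (n + 1)%Z with (Z.of_nat i) by lia.
  replace (n - 1)%Z with (Z.of_nat (i - 2)) by lia.
  replace n with (Z.of_nat (i - 1)) by lia.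
  rewrite !of_coefs_nat, H2; ring.
- intros t r mu w Hr Hm Hw; split; [|split].
  + specialize (H (-1)%Z t r mu w Hr Hm Hw).
    rewrite (of_coefs_neg f (-1 - 1)), (of_coefs_neg f (-1)) in H by lia.
    change (-1 - -1)%Z with (Z.of_nat 0) in H; rewrite of_coefs_nat in H.
    rewrite Dplus_zero, Dminus_zero in H; unfold const4 in H; simpl in H; lra.
  + specialize (H 0%Z t r mu w Hr Hm Hw).
    rewrite (of_coefs_neg f (0 - 1)) in H by lia.
    rewrite (const4_neq (fun t r _ w => emis K t r w) (0 - -1)) in H by lia.
    change (0 - -1)%Z with (Z.of_nat 1) in H; change 0%Z with (Z.of_nat 0) in H.
    rewrite !of_coefs_nat, Dplus_zero in H; simpl in H; lra.
  + intros i Hi; specialize (H (Z.of_nat i - 1)%Z t r mu w Hr Hm Hw).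
    rewrite (const4_neq (fun t r _ w => emis K t r w) (Z.of_nat i - 1 - -1)) in H by lia.
    replace (Z.of_nat i - 1 - 1)%Z with (Z.of_nat (i - 2)) in H by lia.
    replace (Z.of_nat i - 1 - -1)%Z with (Z.of_nat i) in H by lia.
    replace (Z.of_nat i - 1)%Z with (Z.of_nat (i - 1)) in H by lia.
    rewrite !of_coefs_nat in H; cbv beta in H; lra.
Qed.

(* Main.v *)
(* Since J is diagonal in the angular moments, an equation [J(f) = a0 + a1 mu]
   forces f to be affine in mu, with mean [- a0 / chit] and slope [- lambda a1].
   At order 0 this gives that f_0 is isotropic and equal to beta_0; at order 1,
   where [D^-(f_0) = mu d(beta_0)/dr], it gives [f_1 = - lambda mu d(beta_0)/dr].
   The angular mean of [D^+(f_0) + D^-(f_1)] is then the trapped transport of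
   beta_0 plus the diffusion term, while by conservation the mean of [J(f_i)] is
   [- chit beta_i]. *)
Require Import Defs.
From Stdlib Require Import Reals ZArith Lra Lia.
From Coquelicot Require Import Coquelicot.
Open Scope R_scope.

(** * Angular moments of polynomials in mu *)

Lemma is_RInt_quadratic (a b d : R) :
  is_RInt (fun x => a + b * x + d * x ^ 2) (-1) 1 (2 * a + 2 / 3 * d).
Proof.
replace (2 * a + 2 / 3 * d) with
  (minus (a * 1 + b / 2 * 1 ^ 2 + d / 3 * 1 ^ 3)
         (a * (-1) + b / 2 * (-1) ^ 2 + d / 3 * (-1) ^ 3))
  by (unfold minus, plus, opp; simpl; field).
apply (is_RInt_derive (fun x => a * x + b / 2 * x ^ 2 + d / 3 * x ^ 3)).
- intros x _; auto_derive; [easy | simpl; field].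
- intros x _; apply (ex_derive_continuous (fun x => a + b * x + d * x ^ 2)).
  auto_derive; easy.
Qed.

Lemma RInt_quadratic (g : R -> R) (a b d : R) :
  (forall x, -1 < x < 1 -> g x = a + b * x + d * x ^ 2) ->
  RInt g (-1) 1 = 2 * a + 2 / 3 * d.
Proof.
intros Hg; rewrite (RInt_ext _ (fun x => a + b * x + d * x ^ 2)).
- apply is_RInt_unique, is_RInt_quadratic.
- intros x; rewrite Rmin_left, Rmax_right by lra; apply Hg.
Qed.

Lemma mean_quadratic (f : field) (t r w a b d : R) :
  (forall mu, -1 < mu < 1 -> f t r mu w = a + b * mu + d * mu ^ 2) ->
  mean f t r w = a + d / 3.
Proof. intros Hf; unfold mean; rewrite (RInt_quadratic _ a b d Hf); field. Qed.

Lemma flux_affine (f : field) (t r w a b : R) :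
  (forall mu, -1 < mu < 1 -> f t r mu w = a + b * mu) ->
  flux f t r w = b / 3.
Proof.
intros Hf; unfold flux; rewrite (RInt_quadratic _ 0 a b).
- field.
- intros mu Hmu; rewrite Hf by easy; ring.
Qed.

Lemma mean_ext (f g : field) (t r w : R) :
  (forall mu, -1 < mu < 1 -> f t r mu w = g t r mu w) ->
  mean f t r w = mean g t r w.
Proof.
intros Hfg; unfold mean; f_equal; apply RInt_ext; intros mu.
rewrite Rmin_left, Rmax_right by lra; apply Hfg.
Qed.

Lemma mean_Jop (K : rates) (f : field) (t r w : R) :
  ex_RInt (fun mu => f t r mu w) (-1) 1 ->
  mean (Jop K f) t r w = - chit K t r w * mean f t r w.
Proof.
intros Hf; unfold mean at 1.
set (k := - (chit K t r w + phi0 K t r w)).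
set (a := phi0 K t r w * mean f t r w).
set (b := 3 * phi1 K t r w * flux f t r w).
(* In mu, the integrand is [k * f + a + b * mu]. The odd [phi1] term integrates to zero and [a]
   cancels the [phi0] part of [k], so scattering conserves particles. *)
pose proof (is_RInt_plus _ _ _ _ _ _
  (is_RInt_scal _ _ _ k _ (RInt_correct _ _ _ Hf)) (is_RInt_quadratic a b 0)) as H.
rewrite (is_RInt_unique _ _ _ (plus (scal k (RInt (fun mu => f t r mu w) (-1) 1))
  (2 * a + 2 / 3 * 0))).
- unfold a, k, mean, plus, scal; simpl; unfold mult; simpl; field.
- revert H; apply is_RInt_ext; intros mu _.
  unfold Jop, coll, k, a, b, plus, scal; simpl; unfold mult; simpl; ring.
Qed.

(** Dividing by [chit + phi0] makes f affine in mu, hence integrable, with coefficients that involve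
    its own mean and flux. Taking these two moments gives decoupled scalar equations for them. The
    mean stays multiplied by [chit], as order 0 needs only the product. *)
Lemma Jop_affine (K : rates) (f : field) (t r w a0 a1 : R) :
  rates_ok K -> 0 < r -> 0 < w ->
  (forall mu, -1 <= mu <= 1 -> a0 + a1 * mu = Jop K f t r mu w) ->
  chit K t r w * mean f t r w = - a0 /\
  forall mu, -1 <= mu <= 1 -> f t r mu w = mean f t r w - lambda K t r w * a1 * mu.
Proof.
intros HK Hr Hw Hf.
destruct (HK t r w Hr Hw) as [_ [_ [_ [HT HL]]]].
unfold Jop, coll, lambda in *.
revert Hf HT HL; generalize (chit K t r w), (phi0 K t r w), (phi1 K t r w).
intros x p q Hf HT HL.
set (b := mean f t r w) in *; set (h := flux f t r w) in *.
assert (Hsol : forall mu, -1 <= mu <= 1 ->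
  f t r mu w = (p * b - a0) / (x + p) + (3 * q * h - a1) / (x + p) * mu).
{ intros mu Hmu; specialize (Hf mu Hmu).
  apply (Rmult_eq_reg_l (x + p)); [field_simplify; lra | easy]. }
assert (Hb : b = (p * b - a0) / (x + p) + 0 / 3).
{ apply (mean_quadratic f t r w _ ((3 * q * h - a1) / (x + p)) 0).
  intros mu Hmu; rewrite Hsol by lra; ring. }
assert (Hh : h = (3 * q * h - a1) / (x + p) / 3).
{ apply (flux_affine f t r w ((p * b - a0) / (x + p))).
  intros mu Hmu; apply Hsol; lra. }
assert (Hb' : (x + p) * b = p * b - a0) by (rewrite Hb at 1; field; easy).
assert (Hh' : (x + p) * (3 * h) = 3 * q * h - a1) by (rewrite Hh at 1; field; easy).
split; [lra |].
intros mu Hmu; rewrite (Hsol mu Hmu), <- Hb', <- Hh'.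
(* The flux equation turns [lambda * a1] into [- 3 * h], so the slope is three times the flux. *)
replace a1 with (- (3 * h * (x + p - q))) by lra.
field; easy.
Qed.

(** * Derivatives of functions that agree only on the meaningful range *)

Lemma locally_pos (P : R -> Prop) (x : R) :
  0 < x -> (forall y, 0 < y -> P y) -> locally x P.
Proof.
intros Hx HP; apply (filter_imp (fun y => 0 < y)); [exact HP |].
apply open_gt; exact Hx.
Qed.

Lemma Derive_ext_pos (g h : R -> R) (x : R) :
  0 < x -> (forall y, 0 < y -> g y = h y) -> Derive g x = Derive h x.
Proof. intros Hx Hgh; apply Derive_ext_loc, locally_pos; easy. Qed.

(** Interior angles only: every neighbourhood of -1 or 1 leaves the interval. *)
Lemma Derive_angle_ext (g h : R -> R) (mu : R) :
  -1 < mu < 1 -> (forall m, -1 <= m <= 1 -> g m = h m) -> Derive g mu = Derive h mu.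
Proof.
intros Hmu Hgh; apply Derive_ext_loc.
apply (filter_imp (fun m => -1 < m /\ m < 1)); [intros m Hm; apply Hgh; lra |].
apply filter_and; [apply open_gt | apply open_lt]; easy.
Qed.

Lemma trapped_transport_ext (M : background) (b b' : iso_field) (t r w : R) :
  (forall t r w, 0 < r -> 0 < w -> b t r w = b' t r w) -> 0 < r -> 0 < w ->
  trapped_transport M b t r w = trapped_transport M b' t r w.
Proof.
intros Hb Hr Hw; unfold trapped_transport.
rewrite (Derive_ext (fun s => b s r w) (fun s => b' s r w)) by auto.
rewrite (Derive_ext_pos (fun s => b t s w) (fun s => b' t s w)) by auto.
rewrite (Derive_ext_pos (fun x => b t r x) (fun x => b' t r x)) by auto.
reflexivity.
Qed.

Lemma diffusion_ext (l b b' : iso_field) (t r w : R) :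
  (forall t r w, 0 < r -> 0 < w -> b t r w = b' t r w) -> 0 < r -> 0 < w ->
  diffusion l b t r w = diffusion l b' t r w.
Proof.
intros Hb Hr Hw; unfold diffusion; do 2 f_equal.
apply Derive_ext_pos; [easy | intros s Hs; f_equal].
apply Derive_ext_pos; auto.
Qed.

Lemma trapped_transport_zero (M : background) (t r w : R) :
  trapped_transport M (fun _ _ _ => 0) t r w = 0.
Proof. unfold trapped_transport; rewrite !Derive_const; unfold Rdiv; ring. Qed.

Lemma diffusion_zero (l : iso_field) (t r w : R) :
  diffusion l (fun _ _ _ => 0) t r w = 0.
Proof.
unfold diffusion; rewrite (Derive_ext _ (fun _ => 0)).
- rewrite Derive_const; ring.
- intros s; rewrite Derive_const; ring.
Qed.

(** * Transport of isotropic fields and of fields linear in mu *)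

Definition isotropic (b : iso_field) (f : field) : Prop :=
  forall t r mu w, 0 < r -> -1 <= mu <= 1 -> 0 < w -> f t r mu w = b t r w.

Lemma Dminus_isotropic (b : iso_field) (f : field) (t r mu w : R) :
  isotropic b f -> 0 < r -> -1 <= mu <= 1 -> 0 < w ->
  Defs.Dminus f t r mu w = Derive (fun s => b t s w) r * mu.
Proof.
intros Hf Hr Hmu Hw; unfold Defs.Dminus.
rewrite (Derive_ext_pos (fun s => f t s mu w) (fun s => b t s w)) by auto.
(* The endpoints are included because inverting [Jop] at order 1 asks for the equation on all of
   [-1, 1]; there the factor of the angular derivative vanishes. *)
destruct (Req_dec (mu ^ 2) 1) as [H1 | H1]; [rewrite H1; ring |].
rewrite (Derive_angle_ext _ (fun _ => b t r w) mu); [rewrite Derive_const; ring | | auto].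
assert (mu <> 1 /\ mu <> -1) by (split; intros ->; apply H1; ring); lra.
Qed.

Lemma Dplus_isotropic (M : background) (b : iso_field) (f : field) (t r mu w : R) :
  isotropic b f -> 0 < r -> -1 < mu < 1 -> 0 < w ->
  Dplus M f t r mu w =
  (Derive (fun s => b s r w) t + vel M t r * Derive (fun s => b t s w) r) / light M
  + (mu ^ 2 * (dlnrho M t r / light M + 3 * vel M t r / (light M * r))
     - vel M t r / (light M * r)) * w * Derive (fun x => b t r x) w.
Proof.
intros Hf Hr Hmu Hw; unfold Dplus; cbv zeta.
assert (Hmu' : -1 <= mu <= 1) by lra.
rewrite (Derive_ext (fun s => f s r mu w) (fun s => b s r w)) by auto.
rewrite (Derive_ext_pos (fun s => f t s mu w) (fun s => b t s w)) by auto.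
rewrite (Derive_ext_pos (fun x => f t r mu x) (fun x => b t r x)) by auto.
rewrite (Derive_angle_ext _ (fun _ => b t r w) mu), Derive_const by auto.
ring.
Qed.

Lemma Dminus_linear (g : iso_field) (f : field) (t r mu w : R) :
  (forall t r mu w, 0 < r -> -1 <= mu <= 1 -> 0 < w -> f t r mu w = g t r w * mu) ->
  0 < r -> -1 < mu < 1 -> 0 < w ->
  Defs.Dminus f t r mu w =
  mu ^ 2 * Derive (fun s => g t s w) r + / r * (1 - mu ^ 2) * g t r w.
Proof.
intros Hf Hr Hmu Hw; unfold Defs.Dminus.
assert (Hmu' : -1 <= mu <= 1) by lra.
rewrite (Derive_ext_pos (fun s => f t s mu w) (fun s => g t s w * mu)) by auto.
rewrite (Derive_angle_ext _ (fun m => g t r w * m) mu) by auto.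
rewrite Derive_scal_l, Derive_scal, Derive_id; ring.
Qed.

Lemma beta_neg (h : nat -> field) n t r w : (n < 0)%Z -> beta h n t r w = 0.
Proof. intros Hn; unfold beta, smap; rewrite of_coefs_neg by lia; apply mean_zero. Qed.

(** * The Hilbert expansion at orders 0 and 1 *)

Section Hilbert.

Variables (M : background) (K : rates) (f : nat -> field).
Hypotheses (HM : background_ok M) (HK : rates_ok K) (Hreg : regular f)
  (Hf : hilbert_hierarchy M K f).

Let b0 : iso_field := mean (f 0%nat).
Let g1 : iso_field := fun t r w => - lambda K t r w * Derive (fun s => b0 t s w) r.

Lemma hilbert_order0 t r w : 0 < r -> 0 < w ->
  chit K t r w * b0 t r w = emis K t r w /\
  forall mu, -1 <= mu <= 1 -> f 0%nat t r mu w = b0 t r w.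
Proof.
intros Hr Hw.
destruct (Jop_affine K (f 0%nat) t r w (- emis K t r w) 0 HK Hr Hw) as [Hb Hi].
{ intros mu Hmu; destruct (Hf t r mu w Hr Hmu Hw) as [H0 _]; lra. }
split; [unfold b0; lra |].
intros mu Hmu; rewrite Hi by easy; unfold b0; ring.
Qed.

Lemma hilbert_isotropic : isotropic b0 (f 0%nat).
Proof. intros t r mu w Hr Hmu Hw; apply hilbert_order0; easy. Qed.

Lemma hilbert_order1 t r w : 0 < r -> 0 < w ->
  mean (f 1%nat) t r w = 0 /\
  forall mu, -1 <= mu <= 1 -> f 1%nat t r mu w = g1 t r w * mu.
Proof.
intros Hr Hw.
destruct (Jop_affine K (f 1%nat) t r w 0 (Derive (fun s => b0 t s w) r) HK Hr Hw)
  as [Hb Hl].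
{ intros mu Hmu; destruct (Hf t r mu w Hr Hmu Hw) as [_ [H1 _]].
  rewrite <- H1, (Dminus_isotropic b0) by (easy || apply hilbert_isotropic); ring. }
destruct (HK t r w Hr Hw) as [_ [_ [Hx _]]].
assert (Hm : mean (f 1%nat) t r w = 0).
(* The source at order 1 has no constant part, and [chit] is nonzero. *)
{ apply (Rmult_eq_reg_l (chit K t r w)); lra. }
split; [exact Hm |].
intros mu Hmu; rewrite Hl, Hm by easy; unfold g1; ring.
Qed.

(** Neither [lambda] nor the r-derivative of [b0] is assumed differentiable; their product is, since
    it is, up to sign, f_1 at mu = 1. *)
Lemma ex_derive_slope t r w : 0 < r -> 0 < w -> ex_derive (fun s => g1 t s w) r.
Proof.
intros Hr Hw.
destruct (Hreg 1%nat t r 1 w Hr ltac:(lra) Hw) as [_ [H _]].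
revert H; apply ex_derive_ext_loc, locally_pos; [easy |].
intros s Hs; destruct (hilbert_order1 t s w Hs Hw) as [_ H].
rewrite H by lra; apply Rmult_1_r.
Qed.

Lemma diffusion_slope t r w : 0 < r -> 0 < w ->
  diffusion (lambda K) b0 t r w
  = / 3 * Derive (fun s => g1 t s w) r + 2 / 3 * (/ r * g1 t r w).
Proof.
intros Hr Hw; unfold diffusion.
(* Keeping [lambda] and the derivative of [b0] together as [g1], the product rule is needed only
   against [s ^ 2]. *)
rewrite (Derive_ext _ (fun s => s ^ 2 * (- / 3 * g1 t s w)))
  by (intros s; unfold g1; field).
rewrite Derive_mult, Derive_scal.
- rewrite Derive_pow, Derive_id by (auto_derive; easy); simpl; field; lra.
- auto_derive; easy.
- apply ex_derive_scal, ex_derive_slope; easy.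
Qed.

(** * The angular mean of the scaled equation, order by order *)

Lemma mean_Deps_1 t r w : 0 < r -> 0 < w ->
  mean (fun t r mu w => Dplus M (f 0%nat) t r mu w + Defs.Dminus (f 1%nat) t r mu w) t r w
  = trapped_transport M b0 t r w + diffusion (lambda K) b0 t r w.
Proof.
intros Hr Hw; destruct HM as [Hc _].
set (A := (Derive (fun s => b0 s r w) t + vel M t r * Derive (fun s => b0 t s w) r)
          / light M).
set (W := w * Derive (fun x => b0 t r x) w).
set (P := dlnrho M t r / light M + 3 * vel M t r / (light M * r)).
set (Q := vel M t r / (light M * r)).
set (g' := Derive (fun s => g1 t s w) r).
(* As [mu ^ 2] has mean 1/3, the energy term gets [P / 3 - Q], where the [vel / (c r)] parts cancel
   and a third of [dlnrho / c] remains. The [g1] terms add up to [g' / 3 + 2 / 3 * g1 / r], the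
   diffusion term. *)
rewrite (mean_quadratic _ t r w (A - Q * W + / r * g1 t r w) 0
           (P * W + g' - / r * g1 t r w)).
- rewrite diffusion_slope by easy.
  unfold trapped_transport, A, W, P, Q, g'; field; lra.
- intros mu Hmu.
  rewrite (Dplus_isotropic M b0) by (easy || apply hilbert_isotropic).
  rewrite (Dminus_linear g1) by (easy || (intros; apply hilbert_order1; easy)).
  fold A P Q g'; unfold W; ring.
Qed.

Lemma mean_Deps_neg n t r w : (n < 0)%Z ->
  smap mean (Deps M (of_coefs f)) n t r w = 0.
Proof.
intros Hn; unfold smap, Deps, add4, eps_pow, smap.
rewrite !of_coefs_neg by lia.
rewrite (mean_ext _ (fun _ _ _ _ => 0)), mean_zero; [easy |].
intros mu _; rewrite Dplus_zero, Dminus_zero; ring.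
Qed.

Lemma mean_Deps_0 t r w : 0 < r -> 0 < w ->
  smap mean (Deps M (of_coefs f)) 0%Z t r w = 0.
Proof.
intros Hr Hw; unfold smap, Deps, add4, eps_pow, smap.
rewrite (of_coefs_neg f (0 - 1)) by lia.
change 0%Z with (Z.of_nat 0); rewrite of_coefs_nat.
rewrite (mean_quadratic _ t r w 0 (Derive (fun s => b0 t s w) r) 0); [field |].
intros mu Hmu; rewrite Dplus_zero, (Dminus_isotropic b0);
  [ring | apply hilbert_isotropic | easy | lra | easy].
Qed.

Lemma mean_boltzmann :
  eq3 (smap mean (Deps M (of_coefs f))) (reaction K (beta f)).
Proof.
intros n t r w Hr Hw.
unfold reaction, eps_pow, sub3, scal3.
replace (n - -1)%Z with (n + 1)%Z by lia.
destruct (Z_lt_le_dec n 0) as [Hn | Hn].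
- rewrite mean_Deps_neg by easy.
  destruct (Z.eq_dec n (-1)) as [-> | Hn1].
  + change (-1 + 1)%Z with (Z.of_nat 0); unfold beta, smap; rewrite of_coefs_nat.
    destruct (hilbert_order0 t r w Hr Hw) as [H0 _].
    change (const3 (emis K) (Z.of_nat 0) t r w) with (emis K t r w).
    fold b0; lra.
  + rewrite beta_neg by lia; unfold const3.
    destruct (Z.eqb_spec (n + 1) 0); [lia | ring].
- unfold const3; destruct (Z.eqb_spec (n + 1) 0); [lia |].
  destruct (Z.eq_dec n 0) as [-> | Hn0].
  + rewrite mean_Deps_0 by easy.
    change (0 + 1)%Z with (Z.of_nat 1); unfold beta, smap; rewrite of_coefs_nat.
    destruct (hilbert_order1 t r w Hr Hw) as [H1 _]; rewrite H1; ring.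
  (* Because of the factor 1/epsilon on the collision side, order n is the hierarchy equation of
     index n + 1, here at least 2. *)
  + destruct (Z_of_nat_complete (n + 1) ltac:(lia)) as [i Hi].
    unfold beta, smap, Deps, add4, eps_pow, smap; rewrite Hi.
    replace (n - 1)%Z with (Z.of_nat (i - 2)) by lia.
    replace n with (Z.of_nat (i - 1)) by lia.
    rewrite !of_coefs_nat.
    rewrite (mean_ext _ (Jop K (f i))).
    * rewrite mean_Jop; [ring |].
      (* Integrability does not depend on the angle; 0 is just an admissible one. *)
      apply (Hreg i t r 0 w); lra.
    * intros mu Hmu; destruct (Hf t r mu w Hr ltac:(lra) Hw) as [_ [_ H]].
      apply H; lia.
Qed.

(** Since [bt] sits at order 0, the right-hand side lives at order 1 only. On the left, orders up to
    1 involve only f_0 and f_1, and order 0 is odd in mu; the higher coefficients first enter at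
    order 2. *)
Lemma mean_Deps_diffusion (bt : series iso_field) : eq3 bt (const3 b0) ->
  eq3_upto 2 (smap mean (Deps M (of_coefs f))) (diffusion_lhs M K bt).
Proof.
intros Hbt n t r w Hn Hr Hw.
unfold diffusion_lhs, trapped_lhs, diffusion_term, add3, eps_pow.
unfold smap at 2 3.
rewrite (trapped_transport_ext M _ (const3 b0 (n - 1)%Z)),
  (diffusion_ext _ _ (const3 b0 (n - 1)%Z)) by (easy || apply Hbt).
destruct (Z.eq_dec n 1) as [-> | Hn1].
- unfold smap, Deps, add4, eps_pow, smap.
  change (1 - 1)%Z with (Z.of_nat 0); change 1%Z with (Z.of_nat 1).
  rewrite !of_coefs_nat; apply mean_Deps_1; easy.
- unfold const3; destruct (Z.eqb_spec (n - 1) 0); [lia |].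
  rewrite trapped_transport_zero, diffusion_zero, Rplus_0_r.
  destruct (Z.eq_dec n 0) as [-> | Hn0].
  + apply mean_Deps_0; easy.
  + apply mean_Deps_neg; lia.
Qed.

End Hilbert.

(** * The decomposition into trapped and streaming particles *)

Lemma beta_split (f g h : nat -> field) :
  angle_integrable f -> angle_integrable g ->
  (forall i t r mu w, 0 < r -> -1 <= mu <= 1 -> 0 < w ->
     f i t r mu w = g i t r mu w + h i t r mu w) ->
  eq3 (beta f) (add3 (beta g) (beta h)).
Proof.
intros If Ig Hs n t r w Hr Hw; unfold add3.
destruct (Z_lt_le_dec n 0) as [Hn | Hn]; [rewrite !beta_neg by easy; ring |].
destruct (Z_of_nat_complete n Hn) as [i ->].
unfold beta, smap; rewrite !of_coefs_nat.
(* Integrability of h comes from writing it as f - g. *)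
unfold mean; rewrite (is_RInt_unique (fun mu => h i t r mu w) (-1) 1
  (RInt (fun mu => f i t r mu w) (-1) 1 - RInt (fun mu => g i t r mu w) (-1) 1)).
- field.
- apply is_RInt_ext with (fun mu => minus (f i t r mu w) (g i t r mu w)).
  + intros mu; rewrite Rmin_left, Rmax_right by lra; intros Hmu.
    rewrite Hs by lra; unfold minus, plus, opp; simpl; ring.
  + apply (is_RInt_minus (V := R_NormedModule));
      apply (RInt_correct (V := R_CompleteNormedModule));
      [apply If | apply Ig]; easy.
Qed.

Theorem theorem2p20 (M : background) (K : rates) (f ft fs : nat -> field)
  (hM : background_ok M) (hK : rates_ok K)
  (hreg : regular f) (hint : angle_integrable ft)
  (hf : hilbert_hierarchy M K f)
  (hsplit : forall i t r mu w, 0 < r -> -1 <= mu <= 1 -> 0 < w ->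
     f i t r mu w = ft i t r mu w + fs i t r mu w)
  (hbt : eq3 (beta ft) (const3 (mean (f 0%nat)))) :
  eq3 (beta f) (add3 (beta ft) (beta fs)) /\
  eq3 (smap mean (Deps M (of_coefs f))) (reaction K (beta f)) /\
  eq3_upto 2 (smap mean (Deps M (of_coefs f))) (diffusion_lhs M K (beta ft)) /\
  eq3 (reaction K (beta f)) (reaction K (add3 (beta ft) (beta fs))) /\
  (forall Sigma : series iso_field,
     trapped_equation M K (beta ft) Sigma ->
     eq3_upto 2 Sigma (Sigma_diff K (beta ft) (beta fs))).
Proof.
assert (Hint : angle_integrable f).
{ intros i t r w Hr Hw; apply (hreg i t r 0 w); lra. }
assert (Hsum := beta_split f ft fs Hint hint hsplit).
assert (Hmean := mean_boltzmann M K f hK hreg hf).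
assert (Hdiff := mean_Deps_diffusion M K f hM hK hreg hf (beta ft) hbt).
assert (Hreac : eq3 (reaction K (beta f)) (reaction K (add3 (beta ft) (beta fs)))).
{ intros n t r w Hr Hw; unfold reaction, eps_pow, sub3, scal3.
  rewrite Hsum by easy; reflexivity. }
do 4 (split; [assumption |]).
intros Sigma HS n t r w Hn Hr Hw.
specialize (HS n t r w Hr Hw); specialize (Hdiff n t r w Hn Hr Hw).
(* Both equations now contain the same trapped transport. Subtracting them cancels it, along with
   the emission and [chit * beta ft], and leaves the diffusion term plus [chit * beta fs] at order n
   + 1, hence up to order 2. *)
rewrite Hmean, Hreac in Hdiff by easy.
revert HS Hdiff.
unfold Sigma_diff, diffusion_lhs, reaction, add3, sub3, eps_pow, scal3; lra.
Qed.
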